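(* Let $f$ be a location function on the $n$-cube $Q_n$. Then $f=AM$ if and only if $f$ satisfies (T), (Min), and (RR).
   Context: $Q_n=(X,E)$ is the $n$-dimensional hypercube graph with vertex set $X=\{0,1\}^n$ and distance $d(u,v)=\sum_{i=1}^n|u_i-v_i|$ (Hamming distance). A profile is a finite sequence $\pi=(v_1,\dots,v_k)$ of vertices of $X$ of any length $k\ge 1$; $X^*=\bigcup_{k\ge1}X^k$ is the set of all profiles. A location function (also called consensus function) on $Q_n$ is a map $f:X^*\to 2^X\setminus\{\emptyset\}$. For $u,v\in X$, $u\oplus v$ denotes coordinatewise addition modulo 2, and $\pi\oplus v=(v_1\oplus v,\dots,v_k\oplus v)$. The anti-median function $AM$ is defined by $AM(\pi)=\{x\in X: S_\pi(x)\text{ is maximum}\}$, where $S_\pi(x)=\sum_{i=1}^k d(x,v_i)$ and the maximum is over all $x\in X$. For a profile $\pi=(v_1,\dots,v_k)$ write $v_j=(x_1^j,\dots,x_n^j)\in\{0,1\}^n$ for $j=1,\dots,k$. Translation (T): for every profile $\pi$ and all vertices $u,v\in X$, $u\in f(\pi)$ implies $u\oplus v\in f(\pi\oplus v)$. (Min): $Min(\pi)\in f(\pi)$ for every profile $\pi$, where $Min(\pi)=(m_1,\dots,m_n)\in X$ is the vertex with $m_i=1$ if and only if $\sum_{j=1}^k x_i^j<\frac{k}{2}$, for $i=1,\dots,n$. Restricted Range (RR): $|f(\pi)|\le 2^{Cs(\pi)}$ for every profile $\pi$, where the Condorcet score of $\pi$ is $Cs(\pi)=\left|\{i\in\{1,\dots,n\}:\sum_{j=1}^k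 x_i^j=\frac{k}{2}\}\right|$. *)

(* Defs.v *)
From HB Require Import structures.
From mathcomp Require Import all_boot all_order all_algebra.

Set Implicit Arguments.
Unset Strict Implicit.
Unset Printing Implicit Defensive.

(* The vertex set {0,1}^n; coordinates are booleans, coerced to 0/1 in sums. *)
Definition cube (n : nat) := {ffun 'I_n -> bool}.

(* The subtraction is that of [int] (`|m - n|%N), not truncated. *)
Definition hdist n (u v : cube n) : nat :=
  \sum_(i < n) `|(u i : nat) - (v i : nat)|%N.

(* Coordinatewise addition modulo 2; (+) on booleans is exclusive or. *)
Definition oplus n (u v : cube n) : cube n := [ffun i => u i (+) v i].

(* X^*: profiles of arbitrary length k >= 1; k is [size pi]. *)
Record profile (n : nat) := Profile {
  profile_seq :> seq (cube n);
  profile_gt0 : 0 < size profile_seq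
}.

HB.instance Definition _ n := [isSub for @profile_seq n].

Lemma poplus_subproof n (pi : profile n) (v : cube n) :
  0 < size [seq oplus w v | w <- pi].
Proof. by rewrite size_map profile_gt0. Qed.

Definition poplus n (pi : profile n) (v : cube n) : profile n :=
  Profile (poplus_subproof pi v).

Record location_function (n : nat) := LocationFunction {
  location_fun :> profile n -> {set cube n};
  location_neq0 : forall pi, location_fun pi != set0
}.

Definition remoteness n (pi : profile n) (x : cube n) : nat :=
  \sum_(v <- pi) hdist x v.

Definition am_set n (pi : profile n) : {set cube n} :=
  [set x | [forall y, remoteness pi y <= remoteness pi x]].

Lemma am_set_neq0 n (pi : profile n) : am_set pi != set0.
Proof.
apply/set0Pn; case: (arg_maxnP (remoteness pi) (erefl (predT [ffun=> false]))).
by move=> x _ xmax; exists x; rewrite inE; apply/forallP => y; apply: xmax.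
Qed.

Definition AM n : location_function n := LocationFunction (@am_set_neq0 n).

Definition coord_sum n (pi : profile n) (i : 'I_n) : nat :=
  \sum_(v <- pi) (v i : nat).

(* Comparisons of [coord_sum pi i] with k/2 are multiplied out by 2, so that
   no truncated halving of k occurs. *)
Definition Min n (pi : profile n) : cube n :=
  [ffun i => 2 * coord_sum pi i < size pi].

Definition condorcet_score n (pi : profile n) : nat :=
  #|[set i : 'I_n | 2 * coord_sum pi i == size pi]|.

Definition translation n (f : location_function n) : Prop :=
  forall (pi : profile n) (u v : cube n),
    u \in f pi -> oplus u v \in f (poplus pi v).

Definition min_axiom n (f : location_function n) : Prop :=
  forall pi : profile n, Min pi \in f pi.

Definition restricted_range n (f : location_function n) : Prop :=
  forall pi : profile n, #|f pi| <= 2 ^ condorcet_score pi.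

(* Main.v *)
Require Import Defs.
From mathcomp Require Import all_boot.

(** Remoteness is separable: a profile [pi] and a vertex [x] disagree
    coordinate by coordinate, so maximising the remoteness means choosing, in
    each coordinate separately, the value which fewer members of [pi] take.
    Hence [AM pi] is a subcube: its vertices agree with [Min pi] in every
    coordinate which is not tied and are arbitrary in the tied ones
    ([mem_AM]), so that it has exactly [2 ^ condorcet_score pi] elements
    ([card_AM]). This gives the second and third axioms for [AM]; the first
    holds because translations of the cube are isometries.

    Conversely, let [f] satisfy the axioms and let [x] be in [AM pi]. The
    vector [v := oplus x (Min pi)] vanishes outside the tied coordinates.
    Translating [pi] by such a [v] does not change [Min], because an exchange
    of 0 and 1 preserves a tie ([Min_translate]). So [Min pi] belongs to
    [f (poplus pi v)], and translating back by [v] puts [x] in [f pi]. Thus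
    [AM pi] is contained in [f pi] ([AM_sub]); the cardinality bound on [f pi]
    is the cardinality of [AM pi], and the two sets coincide. *)

Set Implicit Arguments.
Unset Strict Implicit.
Unset Printing Implicit Defensive.

Section Disagreement.

Variable n : nat.
Implicit Types (pi : profile n) (x y v : cube n) (i : 'I_n) (b : bool).

Lemma oplusK v : involutive (fun x => oplus x v).
Proof. by move=> x; apply/ffunP => i; rewrite !ffunE addbK. Qed.

Lemma poplusK v : involutive (fun pi => poplus pi v).
Proof.
move=> pi; apply: val_inj => /=; rewrite -map_comp -[RHS]map_id.
by apply: eq_map => w /=; rewrite oplusK.
Qed.

Definition disagreement pi i b : nat := \sum_(v <- pi) (b != v i).

Definition tied pi i : bool := 2 * coord_sum pi i == size pi.

Lemma remotenessE pi x : remoteness pi x = \sum_i disagreement pi i (x i).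
Proof.
rewrite /remoteness /disagreement exchange_big; apply: eq_bigr => i _ /=.
by apply: eq_bigr => v _; case: (x i); case: (v i).
Qed.

Lemma disagreement_false pi i : disagreement pi i false = coord_sum pi i.
Proof. by apply: eq_bigr => v _; case: (v i). Qed.

Lemma disagreement_sum pi i :
  disagreement pi i false + disagreement pi i true = size pi.
Proof.
by rewrite -big_split -sum1_size; apply: eq_bigr => v _ /=; case: (v i).
Qed.

(** [coord_sum pi i] counts the members of [pi] that disagree with 0; those
    that disagree with 1 are the rest of [pi]. So comparing the former with half
    the length of [pi] is comparing the two disagreements, a form on which the
    effect of a translation can be read off. *)
Lemma tiedE pi i :
  tied pi i = (disagreement pi i false == disagreement pi i true).
Proof.
by rewrite /tied -(disagreement_sum pi i) -disagreement_false mul2n -addnn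
           eqn_add2l.
Qed.

Lemma MinE pi i :
  Min pi i = (disagreement pi i false < disagreement pi i true).
Proof.
by rewrite ffunE -(disagreement_sum pi i) -disagreement_false mul2n -addnn
           ltn_add2l.
Qed.

Lemma disagreement_translate pi v i b :
  disagreement (poplus pi v) i b = disagreement pi i (b (+) v i).
Proof.
rewrite /disagreement big_map; apply: eq_bigr => w _; rewrite ffunE.
by case: b; case: (w i); case: (v i).
Qed.

Lemma remoteness_translate pi v x :
  remoteness (poplus pi v) x = remoteness pi (oplus x v).
Proof.
rewrite !remotenessE; apply: eq_bigr => i _.
by rewrite disagreement_translate ffunE.
Qed.

(** In a tied coordinate both minima are 0, the value that [Min] takes in case
    of a tie, and a tie survives the exchange of 0 and 1. *)
Lemma Min_translate pi v :
  (forall i, v i -> tied pi i) -> Min (poplus pi v) = Min pi.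
Proof.
move=> v_tied; apply/ffunP => i; rewrite !MinE !disagreement_translate.
case vi: (v i) => //=.
by have := v_tied i vi; rewrite tiedE => /eqP->; rewrite ltnn.
Qed.

Lemma coordinate_max pi i b :
  (forall b', disagreement pi i b' <= disagreement pi i b) <->
  tied pi i || (b == Min pi i).
Proof.
rewrite tiedE MinE; split=> [/[dup] /(_ false) + /(_ true)|max_b b'].
  by case: b => /=; case: ltngtP.
by move: max_b; case: b; case: b' => //=; case: ltngtP.
Qed.

(** A vertex that maximises the remoteness is optimal in each coordinate, since
    otherwise changing that coordinate alone would increase the remoteness. *)
Lemma mem_AM pi x :
  (x \in AM n pi) = [forall i, tied pi i || (x i == Min pi i)].
Proof.
rewrite inE; apply/forallP/forallP => [x_max i|x_opt y].
  apply/coordinate_max => b.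
  have := x_max [ffun j => if j == i then b else x j].
  rewrite !remotenessE (bigD1 i) //= [leqRHS](bigD1 i) //= ffunE eqxx.
  rewrite (eq_bigr (fun j => disagreement pi j (x j))) ?leq_add2r //.
  by move=> j /negPf ji; rewrite ffunE ji.
rewrite !remotenessE; apply: leq_sum => i _.
by apply: (coordinate_max pi i (x i)).2.
Qed.

Lemma card_AM pi : #|AM n pi| = 2 ^ condorcet_score pi.
Proof.
pose F i := [pred b | tied pi i || (b == Min pi i)].
have -> : #|AM n pi| = #|family F| by apply: eq_card => x; rewrite mem_AM.
rewrite card_family foldrE big_map big_enum /=.
have cardF i : #|F i| = if tied pi i then 2 else 1.
  rewrite /F; case: (tied pi i); last exact: (card1 (Min pi i)).
  by rewrite -[RHS]card_bool; apply: eq_card.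
rewrite (eq_bigr _ (fun i _ => cardF i)) -big_mkcond prod_nat_const.
by congr (2 ^ _); rewrite /condorcet_score; apply: eq_card => i; rewrite inE.
Qed.

Lemma AM_translation : translation (AM n).
Proof.
move=> pi u v; rewrite !inE => /forallP u_max; apply/forallP => y.
by rewrite !remoteness_translate oplusK.
Qed.

Lemma AM_sub (f : location_function n) pi :
  translation f -> min_axiom f -> AM n pi \subset f pi.
Proof.
move=> fT fM; apply/subsetP => x; rewrite mem_AM => /forallP x_opt.
pose v := oplus x (Min pi).
have v_tied i : v i -> tied pi i.
  have := x_opt i; rewrite [v i]ffunE.
  by case: tied => //= /eqP->; rewrite addbb.
have := fT _ _ v (fM (poplus pi v)); rewrite (Min_translate v_tied) poplusK.
suff -> : oplus (Min pi) v = x by [].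
by apply/ffunP => i; rewrite !ffunE addbC addbK.
Qed.

End Disagreement.

Theorem corollary4 (n : nat) (f : location_function n) :
  f =1 AM n <-> translation f /\ min_axiom f /\ restricted_range f.
Proof.
split=> [fE|[fT [fM fRR]] pi].
  split=> [pi u v|]; first by rewrite !fE; apply: AM_translation.
  split=> pi; rewrite fE ?card_AM // mem_AM.
  by apply/forallP => i; rewrite eqxx orbT.
by apply/esym/eqP; rewrite eqEcard (AM_sub pi fT fM) card_AM fRR.
Qed.
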